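(* Let $C$ be a finite simple skew brace which is not a trivial skew brace, write $(C,+)=A$ and $(C,\circ)=R$, and suppose that $R$ admits a surjective homomorphism onto a non-trivial finite abelian group $Q$. Fix a prime $p\in\pi(Q)$. Then there exists a sequence of finite simple skew braces $C=C_0,C_1,C_2,\ldots$ such that $(C_m,+)\cong A^{p^m}$ for every $m\ge0$, each $C_m$ embeds diagonally as a subbrace of $C_{m+1}$, and $(C_m,\circ)$ admits a surjective homomorphism onto $Q$ for every $m$. If $(C,\circ)$ is solvable, then every $(C_m,\circ)$ is solvable.
   Context: A skew brace is a triple $(B,+,\circ)$ such that $(B,+)$ and $(B,\circ)$ are groups (neither assumed abelian) on the same set and $a\circ(b+c)=a\circ b-a+a\circ c$ for all $a,b,c\in B$. The two identity elements coincide and are denoted $0$. Its lambda map is $\lambda^B:(B,\circ)\to\mathrm{Aut}(B,+)$, $\lambda^B_a(b)=-a+a\circ b$. The skew brace is trivial if $a\circ b=a+b$ for all $a,b$. An ideal is a subgroup $I\le(B,+)$ with $I\trianglelefteq(B,+)$, $I\trianglelefteq(B,\circ)$ and $\lambda^B_a(I)=I$ for all $a\in B$. A non-zero skew brace is simple if its only ideals are $0$ and $B$. A subbrace is a subset that is a subgroup of both $(B,+)$ and $(B,\circ)$. For a finite group $H$, $\pi(H)$ denotes the set of prime divisors of $|H|$. ''$C_m$ embeds diagonally as a subbrace of $C_{m+1}$'' means that there is a group isomorphism $\psi:(C_{m+1},+)\to(C_m,+)^p$ such that $C_m\to C_{m+1}$, $a\mapsto\psi^{-1}(a,\dots,a)$,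 is an injective homomorphism of skew braces (respecting both $+$ and $\circ$). *)

(* Defs.v *)
From HB Require Import structures.
From mathcomp Require Import all_boot all_fingroup all_solvable.

Set Implicit Arguments.
Unset Strict Implicit.
Unset Printing Implicit Defensive.

Local Open Scope group_scope.

HB.mixin Record Finite_isSkewBrace B of Finite B := {
  badd : B -> B -> B;
  bzero : B;
  bopp : B -> B;
  bcirc : B -> B -> B;
  bunit : B;
  binv : B -> B;
  baddA : associative badd;
  badd0b : left_id bzero badd;
  baddNb : left_inverse bzero bopp badd;
  bcircA : associative bcirc;
  bcirc1b : left_id bunit bcirc;
  bcircVb : left_inverse bunit binv bcirc;
  bcircD : forall a b c,
    bcirc a (badd b c) = badd (badd (bcirc a b) (bopp a)) (bcirc a c);
}.

#[short(type="finSkewBraceType")]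
HB.structure Definition FinSkewBrace := {B of Finite_isSkewBrace B & Finite B}.

Local Notation "x +b y" := (badd x y) (at level 50, left associativity).
Local Notation "-b x" := (bopp x) (at level 35, right associativity).
Local Notation "x 'ob' y" := (bcirc x y) (at level 40, left associativity).

(* The groups (B, +) and (B, o) live on two aliases of the carrier of B; both
   are written multiplicatively, as finGroupType has no additive non-abelian
   counterpart. *)
Definition addG (B : finSkewBraceType) : Type := B.
Definition circG (B : finSkewBraceType) : Type := B.

HB.instance Definition _ (B : finSkewBraceType) := Finite.on (addG B).
HB.instance Definition _ (B : finSkewBraceType) := Finite.on (circG B).
HB.instance Definition _ (B : finSkewBraceType) :=
  Finite_isGroup.Build (addG B) (@baddA B) (@badd0b B) (@baddNb B).
HB.instance Definition _ (B : finSkewBraceType) :=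
  Finite_isGroup.Build (circG B) (@bcircA B) (@bcirc1b B) (@bcircVb B).

Lemma addG_mulE (B : finSkewBraceType) (a b : addG B) :
  a * b = (a : B) +b (b : B).
Proof. by []. Qed.

Lemma circG_mulE (B : finSkewBraceType) (a b : circG B) :
  a * b = (a : B) ob (b : B).
Proof. by []. Qed.

Lemma bunitE (B : finSkewBraceType) : bunit = bzero :> B.
Proof.
have := bcircD (bunit : B) bzero bzero; rewrite badd0b !bcirc1b.
move=> E; have {E} : (1 * (bunit : addG B)^-1) * 1 = 1 :> addG B by [].
by rewrite mul1g mulg1 => /(canRL invgK); rewrite invg1.
Qed.

Section SkewBraceNotions.

Variable B : finSkewBraceType.

Definition blambda (a b : B) : B := -b a +b a ob b.

Definition trivial_brace : Prop := forall a b : B, a ob b = a +b b.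

Definition ideal (I : {set B}) : Prop :=
  [/\ group_set (I : {set addG B}),
      (I : {set addG B}) <| [set: addG B],
      group_set (I : {set circG B}),
      (I : {set circG B}) <| [set: circG B]
    & forall a : B, blambda a @: I = I].

Definition simple_brace : Prop :=
  [set: B] <> [set bzero] /\
  forall I : {set B}, ideal I -> I = [set bzero] \/ I = [set: B].

End SkewBraceNotions.

Definition brace_morphism (B D : finSkewBraceType) (f : B -> D) : Prop :=
  (forall a b, f (a +b b) = f a +b f b) /\
  (forall a b, f (a ob b) = f a ob f b).

(* The external direct power G^n, with the pointwise group law. *)
Definition dpower (G : finGroupType) (n : nat) : finGroupType :=
  {dffun forall i : 'I_n, G}.

Definition diag (G : finGroupType) (n : nat) (a : G) : dpower G n :=
  [ffun=> a].

(* As psi is bijective, psi \o iota = diag says that iota is the map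
   a |-> psi^-1 (a, ..., a). *)
Definition diagonal_embedding (p : nat) (B D : finSkewBraceType) : Prop :=
  exists (psi : {morphism [set: addG D] >-> dpower (addG B) p})
         (iota : B -> D),
    [/\ isom [set: addG D] [set: dpower (addG B) p] psi,
        forall a : B, psi (iota a) = diag p (a : addG B),
        injective iota
      & brace_morphism iota].

(* Main.v *)
Require Import Defs.
From HB Require Import structures.
From mathcomp Require Import all_boot all_fingroup all_algebra all_solvable.

(* Let [f : (B, o) -> Z/p] be a surjective character. On [B^p] keep the
   componentwise addition and replace the componentwise [o] by
   [a o' b = a o sigma^(F a) b], where [sigma] is the cyclic shift of the
   coordinates and [F a] is the sum of the [f (a_i)]; this is associative since
   [F] is invariant under [sigma]. On the diagonal [F] vanishes, so [B] embeds
   there, and the coordinatewise sum of any character of [(B, o)] is a character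
   of [(B^p, o')].

   If [B] is simple and non-trivial and [I] is a non-zero ideal of [B^p], then
   conjugating and acting by diagonal elements shows that the intersections and
   the projections of [I] along the coordinates are ideals of [B]. If some
   intersection is non-zero it is all of [B]; elements with [F <> 0] permute the
   coordinates transitively, so [I = B^p]. If all intersections vanish, some
   projection is all of [B], and moving [I] by elements supported on one
   coordinate (under addition and under lambda) shows that [(B, +)] is abelian
   and that [ker f] acts trivially on it. Then [ker f] is a proper ideal, hence
   zero, so [B] has order [p] and is trivial, a contradiction. *)

Set Implicit Arguments.
Unset Strict Implicit.
Unset Printing Implicit Defensive.

Import GRing.Theory FiniteModule.
Local Open Scope group_scope.

Local Notation "x +b y" := (badd x y) (at level 50, left associativity).
Local Notation "-b x" := (bopp x) (at level 35, right associativity).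
Local Notation "x 'ob' y" := (bcirc x y) (at level 40, left associativity).

(** * Identities for lambda and a closure criterion for ideals *)

Section SkewBraceTheory.

Variable B : finSkewBraceType.
Implicit Types (a b c : B) (I : {set B}).

Lemma baddb0 a : a +b bzero = a.
Proof. exact: (@mulg1 (addG B)). Qed.

Lemma baddbN a : a +b -b a = bzero.
Proof. exact: (@mulgV (addG B)). Qed.

Lemma baddKb a b : -b a +b (a +b b) = b.
Proof. exact: (@mulKg (addG B)). Qed.

Lemma baddNKb a b : a +b (-b a +b b) = b.
Proof. exact: (@mulKVg (addG B)). Qed.

Lemma bopp0 : -b (bzero : B) = bzero.
Proof. exact: (@invg1 (addG B)). Qed.

Lemma bcircb0 a : a ob bzero = a.
Proof. by rewrite -bunitE; exact: (@mulg1 (circG B)). Qed.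

Lemma bcirc0b a : bzero ob a = a.
Proof. by rewrite -bunitE; exact: bcirc1b. Qed.

Lemma bcircVb0 a : binv a ob a = bzero.
Proof. by rewrite bcircVb bunitE. Qed.

Lemma bcircNKb a b : a ob (binv a ob b) = b.
Proof. exact: (@mulKVg (circG B)). Qed.

Lemma bcirc_lambda a b : a ob b = a +b blambda a b.
Proof. by rewrite /blambda baddNKb. Qed.

Lemma blambda0 a : blambda a bzero = bzero.
Proof. by rewrite /blambda bcircb0 baddNb. Qed.

Lemma blambda0l a : blambda bzero a = a.
Proof. by rewrite /blambda bopp0 badd0b bcirc0b. Qed.

Lemma blambdaD a b c : blambda a (b +b c) = blambda a b +b blambda a c.
Proof. by rewrite /blambda bcircD !baddA. Qed.

Lemma blambdaM a b c : blambda (a ob b) c = blambda a (blambda b c).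
Proof.
apply: (can_inj (baddKb (a ob b))).
by rewrite -bcirc_lambda -bcircA (bcirc_lambda b c) bcirc_lambda blambdaD baddA
  -bcirc_lambda.
Qed.

Lemma blambda_inj a : injective (blambda a).
Proof.
by apply: (can_inj (g := blambda (binv a))) => b; rewrite -blambdaM bcircVb0
  blambda0l.
Qed.

(** Closure under [ob] follows from x o y = x + lambda_x(y). Finiteness supplies the rest: a closed
    subset containing the identity is a subgroup, and since [blambda a] is injective, mapping [I]
    into [I] already means mapping it onto [I]. *)
Lemma idealP I :
  ideal I <->
  [/\ bzero \in I, {in I &, forall x y, x +b y \in I},
      forall a, {in I, forall x, -b a +b x +b a \in I},
      forall a, {in I, forall x, blambda a x \in I}
    & forall a, {in I, forall x, binv a ob x ob a \in I}].
Proof.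
split=> [[/group_setP[I0 ID] /andP[_ nI] _ /andP[_ ncI] lI]|[I0 ID nI lI ncI]].
  split=> // a x xI.
  - have := memJ_norm (x : addG B) (subsetP nI a (in_setT _)).
    by rewrite /conjg mulgA => ->.
  - by rewrite -(lI a) imset_f.
  have := memJ_norm (x : circG B) (subsetP ncI a (in_setT _)).
  by rewrite /conjg mulgA => ->.
split.
- by apply/group_setP; split.
- apply/andP; split; first exact: subsetT.
  apply/subsetP=> a _; rewrite inE; apply/subsetP=> _ /imsetP[x xI ->].
  by rewrite /conjg mulgA; apply: nI.
- apply/group_setP; split; first by rewrite -[1]/bunit bunitE.
  by move=> x y xI yI; rewrite circG_mulE bcirc_lambda ID ?lI.
- apply/andP; split; first exact: subsetT.
  apply/subsetP=> a _; rewrite inE; apply/subsetP=> _ /imsetP[x xI ->].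
  by rewrite /conjg mulgA; apply: ncI.
move=> a; apply/eqP.
rewrite eqEcard (card_imset _ (@blambda_inj a)) leqnn andbT.
by apply/subsetP=> _ /imsetP[x xI ->]; apply: lI.
Qed.

Lemma ideal_opp I x : ideal I -> x \in I -> -b x \in I.
Proof. by case=> gI _ _ _ _; apply: (groupVr (G := Group gI)). Qed.

End SkewBraceTheory.

(** * Characters of the circle group, valued in additive groups *)

Section Characters.

Record circ_char (B : finSkewBraceType) (V : zmodType) := CircChar {
  char_fun :> B -> V;
  char_circ : forall a b, char_fun (a ob b) = (char_fun a + char_fun b)%R
}.

Variables (B : finSkewBraceType) (V : zmodType) (f : circ_char B V).

Lemma char0 : f bzero = 0%R.
Proof. by apply: (addrI (f bzero)); rewrite -char_circ bcirc0b addr0. Qed.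

Lemma charV a : f (binv a) = (- f a)%R.
Proof. by apply: (addIr (f a)); rewrite -char_circ bcircVb0 addNr char0. Qed.

End Characters.

(** * The twisted power and the ideals it induces on its base *)

(* The character is a phantom argument: it determines the brace structure on
   the type, not its carrier. *)
Definition twist (n : nat) (B : finSkewBraceType)
  (f : circ_char B 'I_n.+2) : Type := {ffun 'I_n.+2 -> B}.

HB.instance Definition _ (n : nat) (B : finSkewBraceType)
  (f : circ_char B 'I_n.+2) := Finite.on (twist f).

Section Twist.

Variables (n : nat) (B : finSkewBraceType) (f : circ_char B 'I_n.+2).

Local Notation T := (twist f).

Definition char_sum (V : zmodType) (g : circ_char B V) (a : T) : V :=
  (\sum_i g (a i))%R.

Lemma char_sum_shift (V : zmodType) (g : circ_char B V) (a : T) k :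
  char_sum g [ffun i => a (i + k)%R] = char_sum g a.
Proof.
rewrite /char_sum [RHS](reindex_inj (addIr k)).
by apply: eq_bigr => i _; rewrite ffunE.
Qed.

Definition twist_add (a b : T) : T := [ffun i => a i +b b i].
Definition twist_zero : T := [ffun=> bzero].
Definition twist_opp (a : T) : T := [ffun i => -b a i].
Definition twist_circ (a b : T) : T :=
  [ffun i => a i ob b (i + char_sum f a)%R].
(** The inverse has character sum [- char_sum f a], so as a left factor it shifts [a] back by that
    amount; its own entries must be shifted to match. *)
Definition twist_inv (a : T) : T :=
  [ffun i => binv (a (i - char_sum f a)%R)].

Lemma char_sum_circ (V : zmodType) (g : circ_char B V) (a b : T) :
  char_sum g (twist_circ a b) = (char_sum g a + char_sum g b)%R.
Proof.
rewrite -[char_sum g b](char_sum_shift g b (char_sum f a)) -big_split /=.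
by apply: eq_bigr => i _; rewrite !ffunE char_circ.
Qed.

Lemma char_sum_inv a : char_sum f (twist_inv a) = (- char_sum f a)%R.
Proof.
rewrite -(char_sum_shift f a (- char_sum f a)) /char_sum -sumrN.
by apply: eq_bigr => i _; rewrite !ffunE charV.
Qed.

Fact twist_addA : associative twist_add.
Proof. by move=> a b c; apply/ffunP=> i; rewrite !ffunE baddA. Qed.

Fact twist_add0 : left_id twist_zero twist_add.
Proof. by move=> a; apply/ffunP=> i; rewrite !ffunE badd0b. Qed.

Fact twist_addN : left_inverse twist_zero twist_opp twist_add.
Proof. by move=> a; apply/ffunP=> i; rewrite !ffunE baddNb. Qed.

Fact twist_circA : associative twist_circ.
Proof.
by move=> a b c; apply/ffunP=> i; rewrite !ffunE char_sum_circ bcircA addrA.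
Qed.

Fact twist_circ1 : left_id twist_zero twist_circ.
Proof.
move=> a; apply/ffunP=> i; rewrite !ffunE bcirc0b /char_sum.
by rewrite big1 ?addr0 // => j _; rewrite ffunE char0.
Qed.

Fact twist_circV : left_inverse twist_zero twist_inv twist_circ.
Proof.
by move=> a; apply/ffunP=> i; rewrite !ffunE char_sum_inv bcircVb0.
Qed.

Fact twist_circD a b c :
  twist_circ a (twist_add b c) =
  twist_add (twist_add (twist_circ a b) (twist_opp a)) (twist_circ a c).
Proof. by apply/ffunP=> i; rewrite !ffunE bcircD. Qed.

HB.instance Definition _ := Finite_isSkewBrace.Build T
  twist_addA twist_add0 twist_addN twist_circA twist_circ1 twist_circV
  twist_circD.

Implicit Types (x y : T) (a b : B) (i j : 'I_n.+2).

Lemma twistP x y : (forall i, x i = y i) -> x = y.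
Proof. by move/ffunP. Qed.

Lemma twist_addE x y i : (x +b y) i = x i +b y i. Proof. exact: ffunE. Qed.
Lemma twist_zeroE i : (bzero : T) i = bzero. Proof. exact: ffunE. Qed.
Lemma twist_oppE x i : (-b x) i = -b x i. Proof. exact: ffunE. Qed.
Lemma twist_circE x y i : (x ob y) i = x i ob y (i + char_sum f x)%R.
Proof. exact: ffunE. Qed.
Lemma twist_invE x i : (binv x) i = binv (x (i - char_sum f x)%R).
Proof. exact: ffunE. Qed.
Lemma twist_lambdaE x y i :
  blambda x y i = blambda (x i) (y (i + char_sum f x)%R).
Proof. by rewrite /blambda twist_addE twist_oppE twist_circE. Qed.

Definition twist_diag a : T := [ffun=> a].

Lemma twist_diagE a i : twist_diag a i = a. Proof. exact: ffunE. Qed.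

Lemma char_sum_diag a : char_sum f (twist_diag a) = 0%R.
Proof.
rewrite /char_sum; under eq_bigr do rewrite ffunE.
rewrite sumr_const card_ord.
(* The sum is [n.+2] copies of [f a], which vanishes modulo [n.+2]. *)
by apply: val_inj; rewrite Zp_mulrn /= modnMl. 
Qed.

(** The shift caused by [x] hits a constant function and is invisible; the one caused by the inverse
    of the diagonal element is zero. *)
Lemma twist_conj_diagE a x i :
  (binv (twist_diag a) ob x ob twist_diag a) i = binv a ob x i ob a.
Proof.
rewrite !twist_circE twist_invE !twist_diagE.
rewrite -[binv (twist_diag a)]/(twist_inv _) char_sum_inv char_sum_diag.
by rewrite oppr0 addr0.
Qed.

Definition twist_single i a : T := [ffun j => if j == i then a else bzero].

Lemma twist_singleE i a j : twist_single i a j = if j == i then a else bzero.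
Proof. exact: ffunE. Qed.

Lemma char_sum_single (V : zmodType) (g : circ_char B V) i a :
  char_sum g (twist_single i a) = g a.
Proof.
rewrite /char_sum (bigD1 i) //= ffunE eqxx big1 ?addr0 // => j /negPf ji.
by rewrite ffunE ji char0.
Qed.

(** Diagonal elements have character sum zero, so lambda and both conjugations by them act within
    each coordinate. Every operation required on [B] is thus lifted by a diagonal element. *)
Lemma ideal_coord (I : {set T}) i : ideal I -> ideal [set (x : T) i | x in I].
Proof.
move=> /idealP[I0 ID nI lI ncI]; apply/idealP; split.
- by apply/imsetP; exists bzero; rewrite // twist_zeroE.
- move=> _ _ /imsetP[x xI ->] /imsetP[y yI ->]; apply/imsetP.
  by exists (x +b y); rewrite ?ID ?twist_addE.
- move=> a _ /imsetP[x xI ->]; apply/imsetP.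
  exists (-b twist_diag a +b x +b twist_diag a); first exact: nI.
  by rewrite !twist_addE twist_oppE twist_diagE.
- move=> a _ /imsetP[x xI ->]; apply/imsetP.
  exists (blambda (twist_diag a) x); first exact: lI.
  by rewrite twist_lambdaE char_sum_diag twist_diagE addr0.
move=> a _ /imsetP[x xI ->]; apply/imsetP.
exists (binv (twist_diag a) ob x ob twist_diag a); first exact: ncI.
by rewrite twist_conj_diagE.
Qed.

Lemma ideal_single (I : {set T}) i :
  ideal I -> ideal [set a | twist_single i a \in I].
Proof.
move=> /idealP[I0 ID nI lI ncI]; apply/idealP; split.
- rewrite inE (_ : twist_single i _ = bzero) //; apply: twistP => j.
  by rewrite twist_singleE twist_zeroE if_same.
- move=> a b; rewrite !inE => aI bI.
  rewrite (_ : twist_single i _ = twist_single i a +b twist_single i b) ?ID //.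
  apply: twistP => j; rewrite twist_addE !twist_singleE.
  by case: eqP; rewrite ?baddb0.
- move=> a b; rewrite !inE => /(nI (twist_diag a)); congr (_ \in I).
  apply: twistP => j; rewrite !twist_addE twist_oppE !twist_singleE twist_diagE.
  by case: eqP; rewrite // baddb0 baddNb.
- move=> a b; rewrite !inE => /(lI (twist_diag a)); congr (_ \in I).
  apply: twistP => j; rewrite twist_lambdaE char_sum_diag addr0 !twist_singleE.
  by rewrite twist_diagE; case: eqP; rewrite // blambda0.
move=> a b; rewrite !inE => /(ncI (twist_diag a)); congr (_ \in I).
apply: twistP => j; rewrite twist_conj_diagE !twist_singleE.
by case: eqP; rewrite // bcircb0 bcircVb0.
Qed.

Lemma ideal_singleT (I : {set T}) :
  ideal I -> (forall i a, twist_single i a \in I) -> I = setT.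
Proof.
move=> /idealP[I0 ID _ _ _] sI; apply/setP=> x; rewrite inE.
(* [y s] truncates [x] to the coordinates in [s]; induction on [s] adds one coordinate at a time,
   and a repeated index changes nothing. *)
pose y (s : seq 'I_n.+2) : T := [ffun j => if j \in s then x j else bzero].
suff yI s : y s \in I.
  rewrite (_ : x = y (enum 'I_n.+2)) ?yI //.
  by apply: twistP => i; rewrite ffunE mem_enum.
elim: s => [|i s IHs].
  by rewrite (_ : y [::] = bzero) //; apply: twistP => j; rewrite !ffunE.
have [is_|/negPf is_] := boolP (i \in s).
  rewrite (_ : y _ = y s) //; apply: twistP => j; rewrite !ffunE inE.
  by case: eqP => //= ->; rewrite is_.
rewrite (_ : y _ = twist_single i (x i) +b y s) ?ID //.
apply: twistP => j; rewrite twist_addE !ffunE inE.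
by case: eqP => [->|_] /=; rewrite ?is_ ?baddb0 ?badd0b.
Qed.

End Twist.

(** * Simplicity of the twisted power *)

(* The lambda action of the p-group [(B, o)] on the p-element set [B] fixes
   [0], hence it fixes everything. *)
Lemma prime_brace_trivial (B : finSkewBraceType) :
  prime #|B| -> trivial_brace B.
Proof.
(* The inverse turns the left action lambda into a right action. *)
move=> prB; pose to (b : B) (a : circG B) : B := blambda a^-1 b.
have to1 : to^~ 1 =1 id.
  by move=> b; rewrite /to invg1 /= -[1]/bunit bunitE blambda0l.
have toM b : act_morph to b.
  by move=> a c; rewrite /to invMg circG_mulE blambdaM.
pose act := TotalAction to1 toM.
have pG : #|B|.-group [set: circG B] by rewrite /pgroup cardsT pnat_id.
have actG : [acts [set: circG B], on setT | act].
  by apply/subsetP=> a _; rewrite !inE; apply/subsetP=> b; rewrite !inE.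
pose F := 'Fix_([set: B] | act)([set: circG B]).
(* The number of fixed points is divisible by [#|B|]; it is positive because zero is fixed, so every
   point is fixed. *)
have := pgroup_fix_mod pG actG; rewrite cardsT modnn => /esym/eqP dvdF.
have F_gt0 : 0 < #|F|.
  apply/card_gt0P; exists bzero; rewrite !inE.
  by apply/subsetP=> a _; rewrite inE /= /to blambda0.
have FT : F = setT.
  by apply/eqP; rewrite eqEcard subsetT cardsT (dvdn_leq F_gt0 dvdF).
move=> a b; have : b \in F by rewrite FT inE.
rewrite !inE => /subsetP/(_ (a : circG B)^-1 (in_setT _)).
rewrite inE /= /to invgK.
by rewrite bcirc_lambda => /eqP ->.
Qed.

(* If the kernel of [f] acts trivially and [(B, +)] is abelian, that kernel is
   an ideal, hence zero, so that [B] has prime order. *)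
Lemma simple_char_ker (B : finSkewBraceType) (V : finZmodType)
    (f : circ_char B V) :
  simple_brace B -> ~ trivial_brace B -> prime #|V| ->
  (forall v, exists a, f a = v) ->
  (forall a b : B, a +b b = b +b a) ->
  ~ (forall k b : B, f k = 0%R -> blambda k b = b).
Proof.
move=> [_ simB] ntB prV f_surj addC lamK.
pose K := [set k | f k == 0%R].
have idK : ideal K.
  apply/idealP; split=> [|x y|a x|a x|a x]; rewrite !inE.
  - by rewrite char0.
  - move=> /eqP fx /eqP fy.
    by rewrite -{1}(lamK x y fx) -bcirc_lambda char_circ fx fy addr0.
  - by rewrite addC baddA baddbN badd0b.
  (* The conjugate [y] lies in the kernel, so a o x = y o a = y + a; commutativity of addition then
     gives lambda_a(x) = y. *)
  - move=> /eqP fx; pose y := a ob x ob binv a.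
    have fy : f y = 0%R by rewrite !char_circ charV fx addr0 addrN.
    have -> : blambda a x = y.
      rewrite /blambda (_ : a ob x = y ob a); last first.
        by rewrite -!bcircA bcircVb0 bcircb0.
      by rewrite bcirc_lambda lamK // addC -baddA baddbN baddb0.
    by rewrite fy.
  by move=> /eqP fx; rewrite !char_circ charV fx addr0 addNr.
have [v v_neq0] : exists v : V, v != 0%R.
  have : 0 < #|predC1 (0%R : V)|.
    by rewrite cardC1 -ltnS prednK ?prime_gt0 ?prime_gt1.
  by case/card_gt0P=> v; exists v.
case: (simB K idK) => [K0 | KT]; last first.
  have [a fa] := f_surj v; have : a \in K by rewrite KT inE.
  by rewrite inE fa (negPf v_neq0).
have f_inj : injective f.
  move=> a b fab; have : binv a ob b \in K.
    by rewrite inE char_circ charV fab addNr.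
  by rewrite K0 inE => /eqP Eab; rewrite -[b](bcircNKb a) Eab bcircb0.
(* Now [f] is bijective, so [#|B|] is the prime [#|V|]. *)
apply/ntB/prime_brace_trivial; congr (prime _): prV.
rewrite -(card_codom f_inj); apply: eq_card => w; rewrite inE.
apply/esym/codomP.
by have [a <-] := f_surj w; exists a.
Qed.

Lemma twist_simple (n : nat) (B : finSkewBraceType) (f : circ_char B 'I_n.+2) :
  simple_brace B -> ~ trivial_brace B -> prime n.+2 ->
  (forall v, exists a, f a = v) -> simple_brace (twist f).
Proof.
move=> simB ntB prn f_surj; have [B_neq0 idB] := simB; split.
  move=> T0; apply: B_neq0; apply/setP=> a; rewrite !inE.
  have : twist_diag f a \in [set: twist f] by rewrite inE.
  rewrite T0 inE => /eqP/(congr1 (fun x : twist f => x 0%R)).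
  by rewrite twist_diagE twist_zeroE => ->; rewrite eqxx.
move=> I idI; have /idealP[I0 ID nI lI ncI] := idI.
have NI := fun x => @ideal_opp _ I x idI.
have [/existsP[x /andP[xI x_neq0]] | ] :=
    boolP [exists x, (x \in I) && (x != bzero)]; last first.
  rewrite negb_exists => /forallP I_0; left; apply/setP=> x; rewrite inE.
  have := I_0 x; rewrite negb_and negbK.
  by case: eqP => [->|_]; rewrite ?orbF // => /negPf.
right; pose J i := [set a | twist_single f i a \in I].
have idJ i : ideal (J i) by apply: ideal_single.
have JT i a : a \in J i -> a != bzero -> J i = setT.
  move=> Ja a0; case: (idB _ (idJ i)) => // J0.
  by move: Ja; rewrite J0 inE (negPf a0).
have [/existsP[[i a] /= /andP[Ja a_neq0]] | ] :=
    boolP [exists u : 'I_n.+2 * B, (u.2 \in J u.1) && (u.2 != bzero)].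
  apply: ideal_singleT => // j b.
  suff /setP/(_ b) : J j = setT by rewrite !inE.
  (* Lambda of the element with single entry [r] at [j] shifts by [f r], and so carries support from
     [i] to [j]. *)
  have [r fr] := f_surj (i - j)%R.
  have {}Ja : twist_single f i a \in I by move: Ja; rewrite inE.
  apply: (JT j (blambda r a)).
    rewrite inE; have := lI (twist_single f j r) _ Ja; congr (_ \in I).
    apply: twistP => k; rewrite twist_lambdaE char_sum_single fr !twist_singleE.
    have [->|kj] := eqVneq k j; first by rewrite addrC subrK eqxx.
    rewrite blambda0l; case: eqP => // ki; case/eqP: kj.
    by apply: (addIr (i - j)%R); rewrite ki addrC subrK.
  apply: contraNneq a_neq0 => E; apply/eqP/(blambda_inj (a := r)).
  by rewrite blambda0.
rewrite negb_exists => /forallP J0; exfalso.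
have {}J0 i a : twist_single f i a \in I -> a = bzero.
  by move=> Ia; have := J0 (i, a); rewrite /= inE Ia /= negbK => /eqP.
have [i xi] : exists i, x i != bzero.
  apply/existsP; apply: contraNT x_neq0; rewrite negb_exists => /forallP x0.
  apply/eqP/twistP => i; rewrite twist_zeroE; apply/eqP.
  by have := x0 i; rewrite negbK.
have PT b : exists2 y, y \in I & y i = b.
  have xP : x i \in [set (y : twist f) i | y in I] by apply/imsetP; exists x.
  have : b \in [set (y : twist f) i | y in I].
    case: (idB _ (ideal_coord i idI)) => [P0|->]; last by rewrite inE.
    by move: xP; rewrite P0 inE (negPf xi).
  by case/imsetP=> y yI ->; exists y.
apply: (simple_char_ker (f := f) simB ntB) => //; first by rewrite card_ord.
  move=> a b; have [y yI <-] := PT b.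
  (* The commutator -y + (-s + y + s) lies in [I] and is supported at [i], hence is zero: [a]
     commutes with [y i], which is an arbitrary [b]. *)
  pose s := twist_single f i a.
  have := ID _ _ (NI _ yI) (nI s _ yI).
  rewrite (_ : _ +b _ = twist_single f i (-b y i +b (-b a +b y i +b a))).
    move/J0 => E; have := baddNKb (y i) (-b a +b y i +b a); rewrite E baddb0.
    by move=> yE; rewrite {1}yE -!baddA baddNKb.
  apply: twistP => j; rewrite !twist_addE !twist_oppE !twist_singleE.
  by case: eqP => [->|_] //; rewrite bopp0 badd0b baddb0 baddNb.
move=> k b fk; have [y yI <-] := PT b.
(* Since [f k = 0], acting by this element shifts nothing, and the difference with [y] is again
   supported at [i], hence zero. *)
have := ID _ _ (NI _ yI) (lI (twist_single f i k) _ yI).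
rewrite (_ : _ +b _ = twist_single f i (-b y i +b blambda k (y i))).
  by move/J0 => E; have := baddNKb (y i) (blambda k (y i)); rewrite E baddb0.
apply: twistP => j; rewrite twist_addE twist_oppE twist_lambdaE.
rewrite char_sum_single fk addr0 !twist_singleE.
by case: eqP => [->|_] //; rewrite blambda0l baddNb.
Qed.

(** * Characters of order p, and their transport to twisted powers *)

(** Dividing [Q] by its p'-core leaves a non-trivial p-group. By solvability it has a normal
    subgroup of prime index, necessarily p, and the resulting quotient of order p is identified with
    ['I_p]. *)
Lemma abelian_prime_char (gT : finGroupType) (Q : {group gT}) (abQ : abelian Q)
    (n : nat) :
  n.+2 \in \pi(Q) ->
  exists chi : fmod_of abQ -> 'I_n.+2,
    {morph chi : u v / (u + v)%R} /\ (forall v, exists u, chi u = v).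
Proof.
set p := n.+2; rewrite mem_primes => /and3P[prp _ dvdpQ].
pose O := 'O_p^'(Q)%G.
have nsO : O <| Q by apply: pcore_normal.
have hallO : p^'.-Hall(Q) O by rewrite nilpotent_pcore_Hall ?abelian_nil.
have pQO : p.-group (Q / O).
  rewrite /pgroup card_quotient ?normal_norm //.
  by case/and3P: hallO => _ _; apply: sub_in_pnat => q _; rewrite !inE /= negbK.
have ntQO : Q / O != 1.
  apply/eqP=> QO1; have p'Q : p^'.-group Q.
    apply: pgroupS (pcore_pgroup _ Q).
    by rewrite -quotient_sub1 ?normal_norm // -QO1.
  by move: p'Q; rewrite /pgroup p'natE // dvdpQ.
have solQO := abelian_sol (quotient_abelian O abQ).
have [H nsH prH] := sol_prime_factor_exists solQO ntQO.
have oH : #|Q / O / H| = p.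
  rewrite card_quotient ?normal_norm //.
  have /pnatP/(_ _ prH (dvdnn _)) := pnat_dvd (dvdn_indexg (Q / O) H) pQO.
  by rewrite indexg_gt0 => /(_ isT); rewrite inE => /eqP.
have : Q / O / H \isog [set: 'I_p].
  have cycH : cyclic (Q / O / H) by rewrite prime_cyclic ?oH.
  have cycI : cyclic [set: 'I_p] by rewrite Zp_cycle cycle_cyclic.
  by rewrite (isog_cyclic_card _ cycH) oH cardsT card_ord eqxx andbT.
case/isogP=> h _ hT.
pose chi (u : fmod_of abQ) : 'I_n.+2 := h (coset H (coset O (fmval u))).
have fQ (u : fmod_of abQ) : fmval u \in Q := fmodP u.
have nOQ u : fmval u \in 'N(O) := subsetP (normal_norm nsO) _ (fQ u).
have QO (u : fmod_of abQ) : coset O (fmval u) \in Q / O by apply: mem_quotient.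
have nHQ u : coset O (fmval u) \in 'N(H) := subsetP (normal_norm nsH) _ (QO u).
exists chi; split=> [u v | v]; last first.
  have : v \in h @* (Q / O / H) by rewrite hT inE.
  case/morphimP=> _ _ /morphimP[_ _ /morphimP[x _ Qx ->] ->] ->.
  by exists (fmod abQ x); rewrite /chi fmodK.
rewrite /chi fmvalA (morphM _ (nOQ u) (nOQ v)) (morphM _ (nHQ u) (nHQ v)).
by rewrite morphM ?mem_quotient ?fQ.
Qed.

Section CharacterOperations.

Variables (B : finSkewBraceType) (V W : zmodType) (f : circ_char B V).

Fact char_comp_subproof (chi : V -> W)
    (chiD : {morph chi : u v / (u + v)%R}) a b :
  (chi \o f) (a ob b) = ((chi \o f) a + (chi \o f) b)%R.
Proof. by rewrite /= char_circ chiD. Qed.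

Definition char_comp chi chiD : circ_char B W :=
  CircChar (@char_comp_subproof chi chiD).

End CharacterOperations.

Section TwistCharacter.

Variables (n : nat) (B : finSkewBraceType) (f : circ_char B 'I_n.+2).
Variables (V : zmodType) (g : circ_char B V).

Definition twist_char : circ_char (twist f) V :=
  CircChar (char_sum_circ (f := f) g).

Lemma twist_char_surj :
  (forall v, exists a, g a = v) -> forall v, exists a, twist_char a = v.
Proof.
move=> g_surj v; have [a <-] := g_surj v; exists (twist_single f 0%R a).
exact: char_sum_single.
Qed.

End TwistCharacter.

(** * The additive and circle groups of the twisted power *)

Section TwistGroups.

Variables (n : nat) (B : finSkewBraceType) (f : circ_char B 'I_n.+2).

Definition twist_dpower (x : addG (twist f)) : dpower (addG B) n.+2 :=
  [ffun i => (x : twist f) i].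

Fact twist_dpowerM : {in setT &, {morph twist_dpower : x y / x * y}}.
Proof. by move=> x y _ _; apply/ffunP=> i; rewrite !ffunE. Qed.

Canonical twist_dpower_morphism := Morphism twist_dpowerM.

Lemma twist_dpower_isom :
  isom [set: addG (twist f)] [set: dpower (addG B) n.+2] twist_dpower.
Proof.
apply/isomP; split.
  apply/injmP=> x y _ _ /ffunP E; apply: (@twistP _ _ f) => i.
  by have := E i; rewrite !ffunE.
apply/setP=> y; rewrite inE; apply/morphimP.
exists ([ffun i => y i] : twist f) => //.
by apply/ffunP=> i; rewrite !ffunE.
Qed.

Lemma twist_diag_inj : injective (twist_diag f).
Proof.
by move=> a b /(congr1 (fun x : twist f => x 0%R)); rewrite !twist_diagE.
Qed.

Lemma twist_diagD a b :
  twist_diag f (a +b b) = twist_diag f a +b twist_diag f b.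
Proof. by apply: twistP => i; rewrite twist_addE !twist_diagE. Qed.

Lemma twist_diag_circ a b :
  twist_diag f (a ob b) = twist_diag f a ob twist_diag f b.
Proof. by apply: twistP => i; rewrite twist_circE !twist_diagE. Qed.

Lemma twist_diagonal_embedding : diagonal_embedding n.+2 B (twist f).
Proof.
exists [morphism of twist_dpower], (twist_diag f); split.
- exact: twist_dpower_isom.
- by move=> a; apply/ffunP=> i; rewrite !ffunE.
- exact: twist_diag_inj.
- by split=> a b; rewrite (twist_diagD, twist_diag_circ).
Qed.

Lemma twist_nontrivial : ~ trivial_brace B -> ~ trivial_brace (twist f).
Proof.
move=> ntB trT; apply: ntB => a b; apply: twist_diag_inj.
by rewrite twist_diag_circ trT -twist_diagD.
Qed.

(** The character sum maps to a cyclic group. On its kernel no shift occurs, so the kernel embeds in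
    a direct power of the circle group of [B]. *)
Lemma twist_sol : solvable [set: circG B] -> solvable [set: circG (twist f)].
Proof.
move=> solB.
pose Ff : circG (twist f) -> 'I_n.+2 := char_sum f.
have FM : {in setT &, {morph Ff : x y / x * y}}.
  by move=> x y _ _; rewrite /Ff circG_mulE /= char_sum_circ.
pose F := Morphism FM; pose K := 'ker F.
rewrite (series_sol (ker_normal F)) -/K; apply/andP; split; last first.
  rewrite (isog_sol (first_isog F)); apply: abelian_sol.
  by apply: abelianS (subsetT _) _; rewrite Zp_cycle cycle_abelian.
pose h (x : circG (twist f)) : dpower (circG B) n.+2 :=
  [ffun i => (x : twist f) i].
have hM : {in K &, {morph h : x y / x * y}}.
  move=> x y /mker Kx _; apply/ffunP=> i; rewrite !ffunE.
  by rewrite [char_sum _ _]Kx addr0.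
pose hm := Morphism hM.
have hI : 'injm hm.
  apply/injmP=> x y _ _ /ffunP E; apply: (@twistP _ _ f) => i.
  by have := E i; rewrite !ffunE.
rewrite -(injm_sol hI) //.
have := @setXn_sol n.+2 (fun=> circG B) (fun=> [set: circG B]%G) (fun=> solB).
apply: solvableS; apply/subsetP=> x _; apply/setXnP=> i; exact: in_setT.
Qed.

End TwistGroups.

(** * Isomorphisms between direct powers *)

Lemma isog_of_bij (G H : finGroupType) (h : G -> H) :
  {morph h : x y / x * y} -> bijective h -> [set: G] \isog [set: H].
Proof.
move=> hM [g hK gK]; apply/isogP; exists (Morphism (in2W hM)).
  by apply/injmP=> x y _ _ /(can_inj hK).
apply/setP=> y; rewrite inE; apply/morphimP.
by exists (g y); rewrite ?inE //= gK.
Qed.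

Lemma dpower1_isog (G : finGroupType) : [set: G] \isog [set: dpower G 1].
Proof.
apply: (@isog_of_bij _ _ (@diag G 1)) => [x y|].
  by apply/ffunP=> i; rewrite !ffunE.
exists (fun y : dpower G 1 => y ord0) => [x|y]; first by rewrite ffunE.
by apply/ffunP=> i; rewrite ffunE (ord1 i).
Qed.

Lemma dpower_mul_isog (G H : finGroupType) (n k l : nat) :
  (n * k)%N = l -> [set: G] \isog [set: dpower H k] ->
  [set: dpower G n] \isog [set: dpower H l].
Proof.
move=> nkl /isogP[g g_inj gT].
have e : #|{: 'I_n * 'I_k}| = l by rewrite card_prod !card_ord.
(* [c] and [c'] are inverse bijections between ['I_l] and the index pairs, along which a power of a
   power is flattened. *)
pose c i : 'I_n * 'I_k := enum_val (cast_ord (esym e) i).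
pose c' u := cast_ord e (enum_rank u).
have cK : cancel c c' by move=> i; rewrite /c' /c enum_valK cast_ordKV.
have c'K : cancel c' c by move=> u; rewrite /c' /c cast_ordK enum_rankK.
have [g' gK g'K] : bijective g.
  apply: inj_card_bij.
    by move=> x y /(injmP g_inj); apply; rewrite in_setT.
  by rewrite -cardsT -gT card_injm // cardsT.
pose h (x : dpower G n) : dpower H l := [ffun i => g (x (c i).1) (c i).2].
apply: (@isog_of_bij _ _ h) => [x y|].
  by apply/ffunP=> i; rewrite !ffunE morphM ?in_setT // ffunE.
pose h' (y : dpower H l) : dpower G n :=
  [ffun i => g' [ffun j => y (c' (i, j))]].
exists h' => [x|y]; apply/ffunP=> i.
  by rewrite ffunE -[RHS]gK; congr g'; apply/ffunP=> j; rewrite !ffunE c'K.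
by rewrite !ffunE g'K ffunE -surjective_pairing cK.
Qed.

(** * Iteration of the twist *)

(** The state pairs a brace with its [V]-valued character: composing with [chi] gives the twist,
    while the full character must survive to provide the map onto [Q] at the next stage. *)
Definition twist_step (n : nat) (V : zmodType) (chi : V -> 'I_n.+2)
    (chiD : {morph chi : u v / (u + v)%R})
    (s : {B : finSkewBraceType & circ_char B V}) :
    {B : finSkewBraceType & circ_char B V} :=
  Tagged (fun B => circ_char B V)
    (twist_char (char_comp (tagged s) chiD) (tagged s)).

Lemma char_homg (gT : finGroupType) (Q : {group gT}) (abQ : abelian Q)
    (B : finSkewBraceType) (g : circ_char B (fmod_of abQ)) :
  (forall v, exists a, g a = v) -> Q \homg [set: circG B].
Proof.
move=> g_surj; pose h (a : circG B) := fmval (g a).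
have hM : {in setT &, {morph h : x y / x * y}}.
  by move=> x y _ _; rewrite /h circG_mulE char_circ fmvalA.
apply/homgP; exists (Morphism hM); apply/setP=> x; apply/morphimP/idP.
  by case=> a _ _ ->; exact: fmodP.
move=> Qx; have [a ga] := g_surj (fmod abQ x); exists a; rewrite ?inE //=.
by rewrite /h ga fmodK.
Qed.

Lemma homg_char (gT : finGroupType) (Q : {group gT}) (abQ : abelian Q)
    (B : finSkewBraceType) :
  Q \homg [set: circG B] ->
  exists g : circ_char B (fmod_of abQ), forall v, exists a, g a = v.
Proof.
case/homgP=> h hT.
have hQ (a : circG B) : h a \in Q by rewrite -hT mem_morphim ?inE.
have hM (a b : B) : fmod abQ (h (a ob b)) = (fmod abQ (h a) + fmod abQ (h b))%R.
  by rewrite -fmodM ?hQ // -morphM ?inE.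
exists (CircChar hM) => v; have : fmval v \in Q := fmodP v.
rewrite -{1}hT => /morphimP[a _ _ va]; exists a.
by rewrite /= -va fmvalK.
Qed.

Theorem corollary4p6 (C : finSkewBraceType) (qT : finGroupType)
    (Q : {group qT}) (p : nat) :
  simple_brace C -> ~ trivial_brace C ->
  abelian Q -> Q :!=: 1%g ->
  (Q \homg [set: circG C])%g ->
  p \in \pi(Q) ->
  exists D : nat -> finSkewBraceType,
    [/\ D 0 = C,
        forall m, simple_brace (D m),
        forall m,
          ([set: addG (D m)] \isog [set: dpower (addG C) (p ^ m)])%g,
        forall m, diagonal_embedding p (D m) (D m.+1)
      & (forall m, (Q \homg [set: circG (D m)])%g) /\
        (solvable [set: circG C] ->
         forall m, solvable [set: circG (D m)])].
Proof.
move=> simC ntC abQ _ homQ piQp.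
have prp : prime p by move: piQp; rewrite mem_primes => /and3P[].
(* A prime is at least 2, which gives the form [n.+2] used by the twist. *)
case: p prp piQp => [|[|n]] // prp piQp.
have [chi [chiD chi_surj]] := abelian_prime_char abQ piQp.
have [g g_surj] := homg_char abQ homQ.
pose s m := iter m (twist_step chiD) (Tagged (fun B => circ_char B _) g).
pose D m := tag (s m).
have Dsurj m : forall v, exists a, tagged (s m) a = v.
  by elim: m => // m IHm; apply: twist_char_surj.
have comp_surj m v : exists a, char_comp (tagged (s m)) chiD a = v.
  have [u <-] := chi_surj v; have [a <-] := Dsurj m u; by exists a.
(* Both properties go through one induction, as simplicity of the twist relies on non-triviality of
   its base. *)
have Dsim m : simple_brace (D m) /\ ~ trivial_brace (D m).
  elim: m => // m [IHsim IHnt]; split; last exact: twist_nontrivial.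
  exact: twist_simple.
exists D; split=> //.
- by move=> m; have [] := Dsim m.
- elim=> [|m IHm]; first exact: dpower1_isog.
  apply: (@isog_trans _ _ _ _ [set: dpower (addG (D m)) n.+2]).
    exact: isom_isog (subxx _) (twist_dpower_isom _).
  by apply: dpower_mul_isog IHm; rewrite expnS.
- by move=> m; apply: twist_diagonal_embedding.
split=> [m | solC m]; first exact: char_homg (Dsurj m).
by elim: m => // m IHm; apply: twist_sol.
Qed.
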